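(* Let $h,m,r,g>0$ and let $N\ge 2$ be an integer. Let $(\Omega^1_{k,k+1},\Omega^2_{k,k+1})\in\mathbb{R}^2$ and $(\Gamma^1_{k+1/2},\Gamma^2_{k+1/2},\Gamma^3_{k+1/2})\in\mathbb{R}^3$, $k=0,\dots,N-1$, be sequences that satisfy the discrete spherical pendulum equations, i.e., for every $k=1,\dots,N-1$, $$\tfrac1h r^2\big(\Omega^1_{k,k+1}-\Omega^1_{k-1,k}\big)=\tfrac12 gr\big(\Gamma^2_{k+1/2}+\Gamma^2_{k-1/2}\big),$$ $$\tfrac1h r^2\big(\Omega^2_{k,k+1}-\Omega^2_{k-1,k}\big)=-\tfrac12 gr\big(\Gamma^1_{k+1/2}+\Gamma^1_{k-1/2}\big),$$ $$\tfrac1h\big(\Gamma^1_{k+1/2}-\Gamma^1_{k-1/2}\big)=-\tfrac14\big(\Omega^2_{k,k+1}+\Omega^2_{k-1,k}\big)\big(\Gamma^3_{k+1/2}+\Gamma^3_{k-1/2}\big),$$ $$\tfrac1h\big(\Gamma^2_{k+1/2}-\Gamma^2_{k-1/2}\big)=\tfrac14\big(\Omega^1_{k,k+1}+\Omega^1_{k-1,k}\big)\big(\Gamma^3_{k+1/2}+\Gamma^3_{k-1/2}\big),$$ $$\tfrac1h\big(\Gamma^3_{k+1/2}-\Gamma^3_{k-1/2}\big)=\tfrac14\big(\Omega^2_{k,k+1}+\Omega^2_{k-1,k}\big)\big(\Gamma^1_{k+1/2}+\Gamma^1_{k-1/2}\big)-\tfrac14\big(\Omega^1_{k,k+1}+\Omega^1_{k-1,k}\big)\big(\Gamma^2_{k+1/2}+\Gamma^2_{k-1/2}\big).$$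 Then the discrete vertical component of spatial momentum is conserved: the quantity $$m r^2\big(\Gamma^1_{k+1/2}\,\Omega^1_{k,k+1}+\Gamma^2_{k+1/2}\,\Omega^2_{k,k+1}\big)$$ does not depend on $k\in\{0,\dots,N-1\}$.
   Context: The equations in the claim are the discrete Hamel integrator, with time step $h$, for a spherical pendulum of mass $m$ and length $r$ in gravity $g$; here $\bm{\Gamma}=(\Gamma^1,\Gamma^2,\Gamma^3)$ is the vertical vector and $\bm{\Omega}=(\Omega^1,\Omega^2,0)$ the angular velocity, both in the body frame. Superscripts on $\Omega$ and $\Gamma$ are component indices, not powers; the half-integer and double-integer subscripts are only labels of the sequence elements. *)

(* Defs.v *)
From mathcomp Require Import all_boot all_order all_algebra.
From mathcomp Require Import reals.

Set Implicit Arguments.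
Unset Strict Implicit.
Unset Printing Implicit Defensive.

Import Order.TTheory GRing.Theory Num.Theory.
Local Open Scope ring_scope.

(* The value at [k] of an angular velocity component [Om1], [Om2] is           *)
(* Omega_{k,k+1}; the value at [k] of a component [Ga1], [Ga2], [Ga3] of the   *)
(* vertical vector is Gamma_{k+1/2}.  The sequences of length [N] are encoded  *)
(* as functions on [nat] of which only the values at 0, ..., N-1 are used.     *)

Definition discrete_spherical_pendulum (R : realType) (h r g : R) (N : nat)
    (Om1 Om2 Ga1 Ga2 Ga3 : nat -> R) : Prop :=
  forall k : nat, (1 <= k <= N.-1)%N ->
  [/\ 1 / h * r ^+ 2 * (Om1 k - Om1 k.-1)
        = 1 / 2 * g * r * (Ga2 k + Ga2 k.-1),
      1 / h * r ^+ 2 * (Om2 k - Om2 k.-1)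
        = - (1 / 2 * g * r * (Ga1 k + Ga1 k.-1)),
      1 / h * (Ga1 k - Ga1 k.-1)
        = - (1 / 4 * (Om2 k + Om2 k.-1) * (Ga3 k + Ga3 k.-1)),
      1 / h * (Ga2 k - Ga2 k.-1)
        = 1 / 4 * (Om1 k + Om1 k.-1) * (Ga3 k + Ga3 k.-1)
    & 1 / h * (Ga3 k - Ga3 k.-1)
        = 1 / 4 * (Om2 k + Om2 k.-1) * (Ga1 k + Ga1 k.-1)
          - 1 / 4 * (Om1 k + Om1 k.-1) * (Ga2 k + Ga2 k.-1)].

Definition vertical_momentum (R : realType) (m r : R)
    (Om1 Om2 Ga1 Ga2 : nat -> R) (k : nat) : R :=
  m * r ^+ 2 * (Ga1 k * Om1 k + Ga2 k * Om2 k).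

(* Main.v *)
(** By the discrete product rule
    [2 (x a - x' a') = (x - x') (a + a') + (x + x') (a - a')],
    the increment of the momentum splits into a part with the increments of
    Gamma and a part with those of Omega.  The equations make each increment
    a multiple of the midpoint sum of the other vector, rotated by a right
    angle in the 1-2 plane, so that both parts vanish separately. *)
Require Import Defs.
From mathcomp Require Import all_boot all_order all_algebra.
From mathcomp Require Import reals ring.

Import Order.TTheory GRing.Theory Num.Theory.
Local Open Scope ring_scope.

Lemma vertical_momentum_step (R : realType) (h m r g : R) (N : nat)
    (Om1 Om2 Ga1 Ga2 Ga3 : nat -> R) (k : nat) :
  h != 0 ->
  discrete_spherical_pendulum h r g N Om1 Om2 Ga1 Ga2 Ga3 ->
  (k.+1 <= N.-1)%N ->
  vertical_momentum m r Om1 Om2 Ga1 Ga2 k.+1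
    = vertical_momentum m r Om1 Om2 Ga1 Ga2 k.
Proof.
move=> h0 pend kN; have [/= eO1 eO2 eG1 eG2 _] := pend k.+1 kN.
apply/eqP; rewrite -subr_eq0 /vertical_momentum; apply/eqP.
(* The product rule, with the increments grouped as the left-hand sides of the equations; [h / 2]
   absorbs their [1 / h] and the rule's factor 2. *)
transitivity (m * h / 2 *
   (r ^+ 2 * ((1 / h * (Ga1 k.+1 - Ga1 k)) * (Om1 k.+1 + Om1 k)
              + (1 / h * (Ga2 k.+1 - Ga2 k)) * (Om2 k.+1 + Om2 k))
    + ((Ga1 k.+1 + Ga1 k) * (1 / h * r ^+ 2 * (Om1 k.+1 - Om1 k))
       + (Ga2 k.+1 + Ga2 k) * (1 / h * r ^+ 2 * (Om2 k.+1 - Om2 k))))).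
  by field.
(* The [Ga3] sum times [Om1] and [Om2] sums occurs with both signs, as does the product of [Ga1] and
   [Ga2] sums. *)
by rewrite eO1 eO2 eG1 eG2; ring.
Qed.

Theorem mainTheorem2 (R : realType) (h m r g : R)
    (hh : 0 < h) (hm : 0 < m) (hr : 0 < r) (hg : 0 < g)
    (N : nat) (hN : (2 <= N)%N)
    (Om1 Om2 Ga1 Ga2 Ga3 : nat -> R)
    (hpend : discrete_spherical_pendulum h r g N Om1 Om2 Ga1 Ga2 Ga3) :
  forall j k : nat, (j <= N.-1)%N -> (k <= N.-1)%N ->
  vertical_momentum m r Om1 Om2 Ga1 Ga2 j
    = vertical_momentum m r Om1 Om2 Ga1 Ga2 k.
Proof.
(* Comparing every index with 0 avoids ordering [j] and [k]. *)
have momentum0 j : (j <= N.-1)%N ->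
    vertical_momentum m r Om1 Om2 Ga1 Ga2 j
      = vertical_momentum m r Om1 Om2 Ga1 Ga2 0.
  elim: j => [//|j IHj] jN.
  rewrite -(IHj (ltnW jN)).
  by apply: vertical_momentum_step hpend jN; apply: lt0r_neq0.
by move=> j k jN kN; rewrite !momentum0.
Qed.
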